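(* Let $W=[w_{mn}]\in\mathbb{R}^{N\times N}$ ($N\ge 2$) be the transition matrix of a continuous-time Markov jump process satisfying the standing assumptions of the context, with steady state $\pi$, and let $a,b\in\mathbb{R}^N$ be observables with $\|a\|_*\|b\|_*\neq 0$. Then for every $\tau\ge 0$, $$\frac{|\delta C_{ba}^\tau|}{\|a\|_*\,\|b\|_*}\;\le\;\tau e^{-g\tau}\,\frac{\sigma}{\Phi\!\left(\frac{\sigma}{2\gamma}\right)}\;\le\;2\tau e^{-g\tau}\sqrt{\sigma\kappa}.$$
   Context: Setting. $W=[w_{mn}]\in\mathbb{R}^{N\times N}$ is time-independent, $w_{mn}\ge 0$ for $m\ne n$ is the jump rate from state $n$ to state $m$, and $w_{nn}=-\sum_{m\ne n}w_{mn}$; the distribution evolves by $\dot p_t=Wp_t$. Local detailed balance is assumed: for $m\neq n$ the log-ratio $\ln(w_{mn}/w_{nm})$ is well defined, i.e. $w_{mn}>0$ if and only if $w_{nm}>0$ (pairs with both rates zero contribute nothing to the sums below). The system is in a steady state $\pi=(\pi_1,\dots,\pi_N)$, a probability vector with $W\pi=0$. Spectral assumptions. The eigenvalues of $W$ satisfy $\lambda_1=0>\mathrm{Re}\,\lambda_2\ge\dots\ge\mathrm{Re}\,\lambda_N$. There are left eigenvectors $v_n^l\in\mathbb{C}^N$, $(v_n^l)^\dagger W=\lambda_n (v_n^l)^\dagger$, normalized by $(v_n^l)^\dagger v_n^l=1$, with $v_1^l$ proportional to the all-one vector, forming a basis of $\mathbb{C}^N$ (fixed once and for all). Spectral gap: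 $g:=-\mathrm{Re}\,\lambda_2>0$. For $z\in\mathbb{C}^N$ with expansion $z=\sum_n\tilde z_n v_n^l$, set $\|z\|_*:=\sum_{n\ge 2}|\tilde z_n|$. Correlations. $\Pi:=\mathrm{diag}(\pi_1,\dots,\pi_N)$. The cross-correlation is $C_{ba}^\tau:=\langle b(\tau)a(0)\rangle=b^\top e^{W\tau}\Pi a$, and $\delta C_{ba}^\tau:=C_{ba}^\tau-C_{ab}^\tau$. Thermodynamic quantities. $j_{mn}:=w_{mn}\pi_n-w_{nm}\pi_m$; entropy production rate $\sigma:=\sum_{m>n}j_{mn}\ln\frac{w_{mn}\pi_n}{w_{nm}\pi_m}$; dynamical activity rate $\gamma:=\sum_{m>n}(w_{mn}\pi_n+w_{nm}\pi_m)$; dynamical state mobility $\kappa:=\sum_{m>n}\frac{j_{mn}}{\ln(w_{mn}\pi_n/w_{nm}\pi_m)}$, where a term with $w_{mn}\pi_n=w_{nm}\pi_m$ is understood by continuity as $w_{mn}\pi_n$. $\Phi:[0,\infty)\to[0,\infty)$ is the inverse function of $u\mapsto u\tanh u$ on $[0,\infty)$. When $\sigma=0$ the expression $\sigma/\Phi(\sigma/2\gamma)$ is understood as its limit $0$. *)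

(* Defs.v *)
From mathcomp Require Import all_boot all_order all_algebra.
From mathcomp Require Import complex.
From mathcomp Require Import all_classical all_reals all_analysis.
Set Implicit Arguments.
Unset Strict Implicit.
Unset Printing Implicit Defensive.
Import Order.TTheory GRing.Theory Num.Theory.
Import numFieldNormedType.Exports.
Local Open Scope classical_set_scope.
Local Open Scope ring_scope.
Local Open Scope complex_scope.
Local Open Scope sesquilinear_scope.

(* A system with N >= 2 states is indexed by 'I_n.+2 (N = n.+2); the states,
   eigenvalues and eigenvectors numbered 1, 2, ..., N are the indices
   0, 1, ..., n.+1. *)

Definition transition_rate_matrix (R : realType) (n : nat)
    (W : 'M[R]_n.+2) : Prop :=
  (forall m k, m != k -> 0 <= W m k) /\
  (forall k, W k k = - \sum_(m | m != k) W m k).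

Definition local_detailed_balance (R : realType) (n : nat)
    (W : 'M[R]_n.+2) : Prop :=
  forall m k, m != k -> (0 < W m k <-> 0 < W k m).

Definition steady_state (R : realType) (n : nat)
    (W : 'M[R]_n.+2) (p : 'cV[R]_n.+2) : Prop :=
  [/\ forall k, 0 <= p k 0, \sum_k p k 0 = 1 & W *m p = 0].

Definition complex_mx (R : realType) (m n : nat) (A : 'M[R]_(m, n)) :
    'M[R[i]]_(m, n) :=
  map_mx (real_complex R) A.

(* [M ^t*] is the conjugate transpose. *)
Record spectral_assumptions (R : realType) (n : nat) (W : 'M[R]_n.+2)
    (lam : 'I_n.+2 -> R[i]) (v : n.+2.-tuple 'cV[R[i]]_n.+2) : Prop := {
  eigenvalues_with_multiplicity :
    char_poly (complex_mx W) = \prod_(k < n.+2) ('X - (lam k)%:P);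
  first_eigenvalue : lam 0 = 0;
  second_eigenvalue : complex.Re (lam 1) < 0;
  eigenvalues_ordered :
    forall i j : 'I_n.+2, (i <= j)%N -> complex.Re (lam j) <= complex.Re (lam i);
  left_eigenvectors :
    forall k, (tnth v k) ^t* *m complex_mx W = lam k *: (tnth v k) ^t*;
  unit_eigenvectors : forall k, (tnth v k) ^t* *m tnth v k = 1%:M;
  first_eigenvector : exists c : R[i], tnth v 0 = c *: const_mx 1;
  eigenvector_basis : basis_of fullv v }.

Definition spectral_gap (R : realType) (n : nat) (lam : 'I_n.+2 -> R[i]) : R :=
  - complex.Re (lam 1).

(* [coord v k z] is the coefficient of [tnth v k] in the expansion of [z] in
   the basis [v]; [Normc.normc] is the modulus, as an element of [R]. *)
Definition star_norm (R : realType) (n : nat)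
    (v : n.+2.-tuple 'cV[R[i]]_n.+2) (z : 'cV[R[i]]_n.+2) : R :=
  \sum_(k < n.+2 | k != 0) Normc.normc (coord v k z).

Definition expmx (R : realType) (n : nat) (A : 'M[R]_n.+1) : 'M[R]_n.+1 :=
  limn (series (fun k => k`!%:R^-1 *: A ^+ k)).

Definition cross_correlation (R : realType) (n : nat) (W : 'M[R]_n.+2)
    (p b a : 'cV[R]_n.+2) (tau : R) : R :=
  (b^T *m expmx (tau *: W) *m diag_mx p^T *m a) 0 0.

Definition correlation_asymmetry (R : realType) (n : nat) (W : 'M[R]_n.+2)
    (p b a : 'cV[R]_n.+2) (tau : R) : R :=
  cross_correlation W p b a tau - cross_correlation W p a b tau.

(* steady-state probability flux of jumps from k to m *)
Definition flux (R : realType) (n : nat) (W : 'M[R]_n.+2) (p : 'cV[R]_n.+2)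
    (m k : 'I_n.+2) : R :=
  W m k * p k 0.

Definition current (R : realType) (n : nat) (W : 'M[R]_n.+2)
    (p : 'cV[R]_n.+2) (m k : 'I_n.+2) : R :=
  flux W p m k - flux W p k m.

(* In the three sums below, a pair whose two rates vanish contributes 0: both
   its fluxes are 0. *)
Definition entropy_production (R : realType) (n : nat) (W : 'M[R]_n.+2)
    (p : 'cV[R]_n.+2) : R :=
  \sum_(m < n.+2) \sum_(k < n.+2 | (k < m)%N)
    current W p m k * ln (flux W p m k / flux W p k m).

Definition dynamical_activity (R : realType) (n : nat) (W : 'M[R]_n.+2)
    (p : 'cV[R]_n.+2) : R :=
  \sum_(m < n.+2) \sum_(k < n.+2 | (k < m)%N) (flux W p m k + flux W p k m).

(* The logarithmic mean (x - y) / ln (x / y), extended by continuity to the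
   diagonal. *)
Definition log_mean (R : realType) (x y : R) : R :=
  if x == y then x else (x - y) / ln (x / y).

Definition state_mobility (R : realType) (n : nat) (W : 'M[R]_n.+2)
    (p : 'cV[R]_n.+2) : R :=
  \sum_(m < n.+2) \sum_(k < n.+2 | (k < m)%N)
    log_mean (flux W p m k) (flux W p k m).

Definition tanh (R : realType) (u : R) : R :=
  (expR u - expR (- u)) / (expR u + expR (- u)).

(* Inverse of the bijection u |-> u * tanh u of [0, +oo[ onto itself; the
   default value 0 is taken only outside of [0, +oo[. *)
Definition Phi (R : realType) : R -> R :=
  'pinv_(fun=> 0) `[0, +oo[ (fun u : R => u * tanh u).

(* Main.v *)
Require Import Defs.
From mathcomp Require Import all_boot all_order all_algebra.
From mathcomp Require Import complex.
From mathcomp Require Import all_classical all_reals all_analysis.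
From mathcomp Require Import ring lra.
Import Order.TTheory GRing.Theory Num.Theory.
Import numFieldNormedType.Exports.
Local Open Scope ring_scope.
Local Open Scope complex_scope.
Set Implicit Arguments.
Unset Strict Implicit.
Unset Printing Implicit Defensive.

(* Dynamics: in the basis of left eigenvectors [exp(tau W)] is diagonal, so
   that with [Q l k = v_l^dagger Pi v_k] the asymmetry is the sum of the terms
   [b_l^* a_k (exp(tau lam_l) - exp(tau lam_k)^* ) Q l k].  The same matrix
   satisfies [(lam_l - lam_k^* ) Q l k = v_l^dagger J v_k], where [J] is the
   matrix of the steady-state currents; the terms with [k] or [l] the constant
   eigenvector vanish, and the mean value bound
   [|exp z - exp w| <= exp(- g tau) |z - w|] together with
   [|v_l^dagger J v_k| <= A], [A] the sum of the [|j_mn|] over the pairs, gives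
   [|delta C| <= tau exp(- g tau) A ||a|| ||b||].
   Thermodynamics: on each edge [2 j_e^2 <= gamma_e sigma_e], so that
   [2 A^2 <= gamma sigma] by Cauchy-Schwarz; with [tanh u >= u / (1 + u)] this
   gives [(sigma / A) tanh (sigma / A) >= sigma / (2 gamma)], that is
   [A <= sigma / Phi].  For the last inequality, the flux sum of an edge is
   [2 kappa_e h coth h], with [h] half of its log-ratio and
   [sigma_e = 4 kappa_e h^2]; since [h coth h] is a concave function of [h^2],
   Jensen's inequality yields [gamma <= 2 kappa s coth s] for
   [s = sqrt(sigma / kappa) / 2], hence [s <= Phi]. *)

(** * Hyperbolic functions and Wilker's inequality *)

Section Hyperbolic.
Context {R : realType}.
Implicit Types x y s : R.

Lemma is_derive_nondecreasing (f df : R -> R) (a b : R) : a <= b ->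
  (forall x, a <= x <= b -> is_derive x 1 f (df x)) ->
  (forall x, a <= x <= b -> 0 <= df x) -> f a <= f b.
Proof.
move=> ab fdf df0.
have [x xab E] : exists2 x, x \in `[a, b]%R & f b - f a = df x * (b - a).
  apply: MVT_segment => // [x|].
    by rewrite in_itv /= => /andP[ax xb]; apply: fdf; rewrite !ltW.
  apply: derivable_within_continuous => x.
  by rewrite in_itv /= => xab; have [] := fdf x xab.
rewrite -subr_ge0 E mulr_ge0 ?subr_ge0 //.
by apply: df0; move: xab; rewrite in_itv.
Qed.

Definition cosh x : R := (expR x + expR (- x)) / 2.
Definition sinh x : R := (expR x - expR (- x)) / 2.

#[global] Instance is_derive_cosh x : is_derive x 1 cosh (sinh x).
Proof.
rewrite /cosh /sinh.
apply: is_derive_eq.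
rewrite /GRing.scale /=.
ring.
Qed.

#[global] Instance is_derive_sinh x : is_derive x 1 sinh (cosh x).
Proof.
rewrite /cosh /sinh.
apply: is_derive_eq.
rewrite /GRing.scale /=.
ring.
Qed.

Lemma cosh2B x : cosh x ^+ 2 - sinh x ^+ 2 = 1.
Proof.
have E := expRxMexpNx_1 x; rewrite /cosh /sinh -[RHS]E.
by field.
Qed.

Lemma cosh_ge1 x : 1 <= cosh x.
Proof.
have := cosh2B x; have := sqr_ge0 (sinh x).
have : 0 < cosh x by rewrite /cosh divr_gt0 ?addr_gt0 ?expR_gt0.
nra.
Qed.

Lemma sinh0 : sinh 0 = 0. Proof. by rewrite /sinh oppr0 subrr mul0r. Qed.

Lemma sinh_ge x : 0 <= x -> x <= sinh x.
Proof.
move=> x0.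
have := @is_derive_nondecreasing (fun y => sinh y - y) (fun y => cosh y - 1) 0 x x0 _ _.
rewrite sinh0 !subr0 subr_ge0; apply => y yx.
by rewrite subr_ge0 cosh_ge1.
Qed.

(* Wilker's inequality [(sinh x / x)^2 + tanh x / x >= 2]. *)
Lemma wilker_sinh x : 0 <= x ->
  0 <= sinh x ^+ 2 * cosh x + x * sinh x - 2 * x ^+ 2 * cosh x.
Proof.
(* [w1] and [w2] are the first two derivatives of [w]; [w] and [w1] vanish at 0, and [w2 >= 0]
   follows from [sinh y >= y] and [cosh y >= 1]. *)
pose w2 (y : R) := 9 * sinh y ^+ 2 * cosh y - 7 * y * sinh y - 2 * y ^+ 2 * cosh y.
pose w1 (y : R) := 3 * sinh y * cosh y ^+ 2 - 3 * y * cosh y - 2 * y ^+ 2 * sinh y.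
pose w (y : R) := sinh y ^+ 2 * cosh y + y * sinh y - 2 * y ^+ 2 * cosh y.
have w2_ge0 y : 0 <= y -> 0 <= w2 y.
  move=> y0; rewrite /w2.
  have := sinh_ge y0; have := cosh_ge1 y.
  set c := cosh y; set s := sinh y => c1 ys.
  have : y ^+ 2 <= s ^+ 2 by rewrite ler_sqr ?nnegrE // (le_trans y0).
  have : y * s <= s ^+ 2 by rewrite expr2 ler_wpM2r // (le_trans y0).
  nra.
have w1_ge0 y : 0 <= y -> 0 <= w1 y.
  move=> y0; have -> : 0 = w1 0 by rewrite /w1 sinh0; ring.
  apply: (@is_derive_nondecreasing _ w2) => // z /andP[z0 _]; last exact: w2_ge0.
  rewrite /w1; apply: is_derive_eq.
  rewrite /GRing.scale /= /w2; have E := cosh2B z.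
  (* The two sides differ by a multiple of [cosh z ^+ 2 - sinh z ^+ 2 - 1], which is 0. *)
  apply: subr0_eq.
  transitivity (3 * cosh z * (cosh z ^+ 2 - sinh z ^+ 2 - 1)); first ring.
  by rewrite E subrr mulr0.
move=> x0; have -> : 0 = w 0 by rewrite /w sinh0; ring.
apply: (@is_derive_nondecreasing _ w1) => // z /andP[z0 _]; last exact: w1_ge0.
rewrite /w; apply: is_derive_eq.
rewrite /GRing.scale /= /w1; have E := cosh2B z.
apply: subr0_eq.
transitivity (- sinh z * (cosh z ^+ 2 - sinh z ^+ 2 - 1)); first ring.
by rewrite E subrr mulr0.
Qed.

End Hyperbolic.

(** * Tangent bounds from the concavity of [y coth y] in [y ^+ 2] *)

Section CothTangent.
Context {R : realType}.
Implicit Types x y s : R.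

Lemma sinh_gt0 x : 0 < x -> 0 < sinh x.
Proof. by move=> x0; apply: lt_le_trans (sinh_ge (ltW x0)). Qed.

Lemma cosh_gt0 x : 0 < cosh x.
Proof. exact: lt_le_trans (cosh_ge1 x). Qed.

Lemma coshN x : cosh (- x) = cosh x.
Proof. by rewrite /cosh opprK addrC. Qed.

Lemma sinhN x : sinh (- x) = - sinh x.
Proof. by rewrite /sinh opprK -mulNr opprB. Qed.

(** Gives both [tanh x <= x] and, for [x > 0], [x coth x >= 1]. *)
Lemma sinh_le_xcosh x : 0 <= x -> sinh x <= x * cosh x.
Proof.
move=> x0; rewrite -subr_ge0.
have -> : 0 = 0 * cosh 0 - sinh 0 :> R by rewrite sinh0 mul0r subr0.
apply: (@is_derive_nondecreasing _ (fun y => y * cosh y - sinh y) (fun y => y * sinh y)) => //.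
  by move=> y _; apply: is_derive_eq; rewrite /GRing.scale /=; ring.
by move=> y /andP[y0 _]; rewrite mulr_ge0 // (le_trans y0) // sinh_ge.
Qed.

(* The derivative of [y * coth y] with respect to [y ^+ 2]. *)
Definition xcoth_slope s : R := (sinh s * cosh s - s) / (2 * s * sinh s ^+ 2).

(** The numerator is the opposite of Wilker's expression, so the slope does not increase with [s]:
    this is the concavity of [y coth y] in [y ^+ 2]. *)
Lemma is_derive_xcoth_slope s : 0 < s -> is_derive s 1 xcoth_slope
  (- (sinh s ^+ 2 * cosh s + s * sinh s - 2 * s ^+ 2 * cosh s)
     / (2 * s ^+ 2 * sinh s ^+ 3)).
Proof.
move=> s0; rewrite /xcoth_slope.
have sh0 : sinh s != 0 by rewrite gt_eqF // sinh_gt0.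
have s0' : s != 0 by rewrite gt_eqF.
have den0 : 2 * s * sinh s ^+ 2 != 0.
  by rewrite (mulf_neq0 (mulf_neq0 _ s0') (expf_neq0 _ sh0)) ?pnatr_eq0.
have dden : is_derive s 1 (fun z => 2 * z * sinh z ^+ 2)
    (2 * sinh s ^+ 2 + 4 * s * sinh s * cosh s).
  by apply: is_derive_eq; rewrite /GRing.scale /=; ring.
have dV := @is_deriveV _ (fun z => 2 * z * sinh z ^+ 2) s _ 1 den0 dden.
apply: is_derive_eq.
rewrite /GRing.scale /=.
have E := cosh2B s; apply: subr0_eq.
transitivity (- (cosh s ^+ 2 - sinh s ^+ 2 - 1) / (2 * s * sinh s ^+ 2)).
  by field; rewrite s0' sh0.
by rewrite E subrr oppr0 mul0r.
Qed.

Lemma is_derive_xcoth s : 0 < s ->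
  is_derive s 1 (fun s => s * cosh s / sinh s) (2 * s * xcoth_slope s).
Proof.
move=> s0; rewrite /xcoth_slope.
have sh0 : sinh s != 0 by rewrite gt_eqF // sinh_gt0.
have s0' : s != 0 by rewrite gt_eqF.
have dV := is_deriveV sh0 (is_derive_sinh s).
apply: is_derive_eq.
rewrite /GRing.scale /=.
have E := cosh2B s; apply: subr0_eq.
transitivity ((1 - (cosh s ^+ 2 - sinh s ^+ 2)) * s / sinh s ^+ 2).
  by field; rewrite s0' sh0.
by rewrite E subrr !mul0r.
Qed.

(* Fixing [y] and moving the tangency point [s]: the derivative in [s] of the
   right-hand side is [D'(s) * (y ^+ 2 - s ^+ 2)], with [D' <= 0]. *)
Lemma xcoth_tangent y s : 0 < y -> 0 < s ->
  y * cosh y / sinh y <= s * cosh s / sinh s + xcoth_slope s * (y ^+ 2 - s ^+ 2).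
Proof.
move=> y0 s0.
pose D' s := - (sinh s ^+ 2 * cosh s + s * sinh s - 2 * s ^+ 2 * cosh s)
     / (2 * s ^+ 2 * sinh s ^+ 3).
have D'_le0 x : 0 < x -> D' x <= 0.
  move=> x0; rewrite /D' mulNr oppr_le0 divr_ge0 ?wilker_sinh ?(ltW x0)//.
  exact: mulr_ge0 (mulr_ge0 (ler0n _ _) (exprn_ge0 _ (ltW x0))) (exprn_ge0 _ (ltW (sinh_gt0 x0))).
pose T s := s * cosh s / sinh s + xcoth_slope s * (y ^+ 2 - s ^+ 2).
have dT x : 0 < x -> is_derive x 1 T (D' x * (y ^+ 2 - x ^+ 2)).
  move=> x0; have dD := is_derive_xcoth_slope x0; have dC := is_derive_xcoth x0.
  rewrite /T; apply: is_derive_eq; rewrite /GRing.scale /= /D'; ring.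
have -> : y * cosh y / sinh y = T y by rewrite /T subrr mulr0 addr0.
(* [T] is nonincreasing before [y] and nondecreasing after it, so [T y <= T s] on either side. *)
rewrite -/(T s); case: (leP y s) => [ys|/ltW sy].
  apply: (@is_derive_nondecreasing _ T (fun x => D' x * (y ^+ 2 - x ^+ 2))) => //.
    by move=> x /andP[yx _]; apply: dT; apply: lt_le_trans yx.
  move=> x /andP[yx _]; have x0 := lt_le_trans y0 yx.
  by apply: mulr_le0 (D'_le0 _ x0) _; rewrite subr_le0 ler_sqr ?nnegrE ?(ltW y0) ?(ltW x0).
rewrite -lerN2.
apply: (@is_derive_nondecreasing _ (fun x => - T x) (fun x => - (D' x * (y ^+ 2 - x ^+ 2)))) => //.
  move=> x /andP[sx _]; have := dT x (lt_le_trans s0 sx) => dTx.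
  exact: is_deriveN.
move=> x /andP[sx xy]; have x0 := lt_le_trans s0 sx.
by rewrite oppr_ge0 (mulr_le0_ge0 (D'_le0 _ x0)) // subr_ge0 ler_sqr ?nnegrE ?(ltW y0) ?(ltW x0).
Qed.

(** The limit of [xcoth_tangent] as [y] tends to 0, where [y coth y] tends to 1; it serves the edges
    with equal fluxes. *)
Lemma xcoth_tangent0 s : 0 < s ->
  1 <= s * cosh s / sinh s - xcoth_slope s * s ^+ 2.
Proof.
move=> s0; set K := _ - _.
have H y : 0 < y -> 1 <= K + xcoth_slope s * y ^+ 2.
  move=> y0; have -> : K + xcoth_slope s * y ^+ 2 =
    s * cosh s / sinh s + xcoth_slope s * (y ^+ 2 - s ^+ 2) by rewrite /K; ring.
  apply: le_trans (xcoth_tangent y0 s0).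
  by rewrite ler_pdivlMr ?sinh_gt0 // mul1r sinh_le_xcosh // ltW.
case: (leP (xcoth_slope s) 0) => [D0|D0].
  by have := H 1 ltr01; rewrite expr1n mulr1; lra.
(* This choice of [y] makes [xcoth_slope s * y ^+ 2] equal to [e]. *)
apply/ler_addgt0Pr => e e0; have := H (Num.sqrt (e / xcoth_slope s)).
rewrite sqrtr_gt0 divr_gt0 // => /(_ isT).
have -> : Num.sqrt (e / xcoth_slope s) ^+ 2 = e / xcoth_slope s.
  by apply: sqr_sqrtr; apply: divr_ge0; apply: ltW.
by rewrite mulrC divfK // gt_eqF.
Qed.

End CothTangent.

(** * The map [u tanh u] and its inverse *)

Section Tanh.
Context {R : realType}.
Implicit Types x y s : R.

Lemma tanhE x : tanh x = sinh x / cosh x.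
Proof.
rewrite /tanh /sinh /cosh; have := expR_gt0 x; have := expR_gt0 (- x) => h1 h2.
by field; rewrite gt_eqF // addr_gt0.
Qed.

(** With [E = expR (2 * x)], [tanh x = (E - 1) / (E + 1)] increases with [E], and
    [E >= 1 + 2 * x]. *)
Lemma tanh_ge x : 0 <= x -> x / (1 + x) <= tanh x.
Proof.
move=> x0; rewrite /tanh.
have e0 := expR_gt0 x; have e1 := expR_gt0 (- x).
have x1 : 0 < 1 + x by apply: ltr_wpDr.
rewrite (ler_pdivrMr _ _ x1) mulrAC (ler_pdivlMr _ _ (addr_gt0 e0 e1)).
have := expR_ge1Dx (2 * x); rewrite (_ : 2 * x = x + x) ?expRD; last by ring.
have := expRxMexpNx_1 x.
move: e0 e1; set a := expR x; set b := expR (- x) => a0 b0 ab h.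
have : b * (1 + (x + x)) <= b * (a * a) by rewrite ler_pM2l.
have -> : b * (a * a) = a by rewrite mulrA [b * a]mulrC ab mul1r.
nra.
Qed.

(** In this form [tanh] is visibly monotone, and rational in [r] at [x = ln r / 2]. *)
Lemma tanh_expR x : tanh x = 1 - 2 / (expR (2 * x) + 1).
Proof.
rewrite /tanh (_ : 2 * x = x + x) ?expRD; last by ring.
have e0 := expR_gt0 x.
have -> : expR (- x) = (expR x)^-1 by rewrite expRN.
by field; rewrite !gt_eqF ?addr_gt0 ?mulr_gt0.
Qed.

Lemma tanh_le x y : x <= y -> tanh x <= tanh y.
Proof.
move=> xy.
rewrite !tanh_expR lerD2l lerN2 ler_pM2l // lef_pV2 ?posrE ?addr_gt0 ?expR_gt0 //.
by rewrite lerD2r ler_expR ler_pM2l.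
Qed.

Lemma tanh_gt0 x : 0 < x -> 0 < tanh x.
Proof. by move=> x0; rewrite tanhE divr_gt0 ?sinh_gt0 ?cosh_gt0. Qed.

Lemma xtanh_lt x y : 0 <= x -> x < y -> x * tanh x < y * tanh y.
Proof.
move=> x0 xy; have y0 := le_lt_trans x0 xy.
apply: (@le_lt_trans _ _ (x * tanh y)).
  by rewrite ler_wpM2l // tanh_le // ltW.
by rewrite ltr_pM2r // tanh_gt0.
Qed.

Lemma continuous_xtanh : continuous (fun x : R => x * tanh x).
Proof.
move=> x; apply/differentiable_continuous/derivable1_diffP.
have -> : (fun x : R => x * tanh x) = (fun x => x * (sinh x / cosh x)).
  by apply/funext => z; rewrite tanhE.
have c0 : cosh x != 0 by rewrite gt_eqF // cosh_gt0.
have dV := is_deriveV c0 (is_derive_cosh x).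
apply: derivableM; first exact: derivable_id.
by apply: derivableM; apply: ex_derive.
Qed.

Lemma PhiP (q : R) : 0 <= q -> 0 <= Phi q /\ Phi q * tanh (Phi q) = q.
Proof.
move=> q0; pose f (u : R) := u * tanh u.
have [u u0 fu] : exists2 u : R, 0 <= u & f u = q.
  (* The right endpoint comes from [tanh_ge]: [f (q + 1) >= (q + 1) ^+ 2 / (q + 2) >= q]. *)
  have [|||c] := @IVT R f 0 (q + 1) q.
  - by rewrite addr_ge0.
  - by apply: continuous_subspaceT => x; exact: continuous_xtanh.
  - rewrite {1 3}/f mul0r.
    have fq : q <= f (q + 1).
      rewrite /f; apply: le_trans (_ : (q + 1) * ((q + 1) / (1 + (q + 1))) <= _).
        by rewrite mulrA ler_pdivlMr; nra.
      by rewrite ler_wpM2l ?tanh_ge ?addr_ge0.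
    by rewrite ge_min q0 /= le_max fq orbT.
  by rewrite in_itv /= => /andP[c0 _] <-; exists c.
(* As [q] is attained on the half-line, the default value of ['pinv_] does not occur. *)
have imq : (f @` `[0, +oo[)%classic q by exists u => //=; rewrite in_itv /= u0.
have surj : set_surj `[0, +oo[%classic (f @` `[0, +oo[)%classic f by [].
split.
  have := @surjpinv_image_sub _ _ (fun=> 0) _ _ f surj (Phi q).
  by rewrite /= in_itv /= andbT; apply; exists q.
exact: (@pinvK _ _ (fun=> 0) `[0, +oo[%classic f q (mem_set imq)).
Qed.

Lemma Phi_le (q z : R) : 0 <= q -> 0 <= z -> q <= z * tanh z -> Phi q <= z.
Proof.
move=> q0 z0 qz; have [u0 uq] := PhiP q0.
rewrite leNgt; apply/negP => zu.
by have := xtanh_lt z0 zu; rewrite uq ltNge qz.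
Qed.

Lemma Phi_ge (q z : R) : 0 <= q -> 0 <= z -> z * tanh z <= q -> z <= Phi q.
Proof.
move=> q0 z0 qz; have [u0 uq] := PhiP q0.
rewrite leNgt; apply/negP => zu.
by have := xtanh_lt u0 zu; rewrite uq ltNge qz.
Qed.

Lemma Phi_gt0 (q : R) : 0 < q -> 0 < Phi q.
Proof.
move=> q0; have [u0 uq] := PhiP (ltW q0).
rewrite lt_neqAle u0 andbT; apply/eqP => u0'.
by move: q0; rewrite -uq -u0' mul0r ltxx.
Qed.

End Tanh.

(** * Inequalities for the two fluxes of an edge *)

Section Fluxes.
Context {R : realType}.
Implicit Types x z s u : R.

(** With [h] half the log-ratio of the fluxes, [tanh h] is the ratio of current to activity on the
    edge. *)
Lemma sub_eq_tanh x z : 0 < x -> 0 < z ->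
  x - z = (x + z) * tanh (ln (x / z) / 2).
Proof.
move=> x0 z0; rewrite tanh_expR mulrCA divff ?pnatr_eq0 // mulr1.
rewrite lnK ?posrE ?divr_gt0 //; field.
by rewrite !gt_eqF // addr_gt0.
Qed.

(** [tanh u] lies between 0 and [u]; both sides are even, which reduces the claim to [u >= 0]. *)
Lemma tanh_sqr_le u : tanh u ^+ 2 <= tanh u * u.
Proof.
have H (w : R) : 0 <= w -> tanh w ^+ 2 <= tanh w * w.
  move=> w0; rewrite expr2 ler_wpM2l //.
    by rewrite tanhE divr_ge0 ?(ltW (cosh_gt0 _)) // (le_trans w0) // sinh_ge.
  by rewrite tanhE ler_pdivrMr ?cosh_gt0 // sinh_le_xcosh.
case: (leP 0 u) => [/H //|/ltW u0].
have E : tanh (- u) = - tanh u by rewrite !tanhE coshN sinhN mulNr.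
by have := H (- u); rewrite oppr_ge0 E sqrrN mulrNN => /(_ u0).
Qed.

(** Excludes an edge with flux in one direction only, where [ln (x / z)] would take a default value
    instead of being infinite. *)
Definition flux_pair x z := (0 < x /\ 0 < z) \/ (x = 0 /\ z = 0).

(** Linearized form of [2 (x - z)^2 <= (x + z) (x - z) ln (x / z)], with [u] as parameter: being
    linear in the three edge quantities, it can be summed over the edges with a common [u]. *)
Lemma abs_sub_le_ln x z u : flux_pair x z ->
  4 * u * `|x - z| <= 2 * u ^+ 2 * (x + z) + (x - z) * ln (x / z).
Proof.
case=> [[x0 z0]|[-> ->]]; last by rewrite subrr normr0 mulr0 addr0 mulr0 mul0r addr0.
have -> : ln (x / z) = 2 * (ln (x / z) / 2) by field.
rewrite (sub_eq_tanh x0 z0); set h := ln _ / 2.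
have a0 : 0 < x + z by rewrite addr_gt0.
rewrite normrM (gtr0_norm a0).
have := tanh_sqr_le h; rewrite -[tanh h ^+ 2]real_normK ?num_real //.
set t := tanh h; set a := x + z => H.
have : 0 <= a * (t * h - `|t| ^+ 2) by rewrite mulr_ge0 ?subr_ge0 // ltW.
have : 0 <= a * (u - `|t|) ^+ 2 by rewrite mulr_ge0 ?sqr_ge0 // ltW.
move=> h1 h2; rewrite -subr_ge0.
have -> : 2 * u ^+ 2 * a + a * t * (2 * h) - 4 * u * (a * `|t|) =
  2 * (a * (u - `|t|) ^+ 2) + 2 * (a * (t * h - `|t| ^+ 2)) by ring.
by apply: addr_ge0; apply: mulr_ge0.
Qed.

Lemma sub_ln_ge0 x z : flux_pair x z -> 0 <= (x - z) * ln (x / z).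
Proof. by move=> /(abs_sub_le_ln 0); rewrite !(mulr0, mul0r, expr0n, add0r). Qed.

Lemma abs_sub_le x z : flux_pair x z -> `|x - z| <= x + z.
Proof.
case=> [[x0 z0]|[-> ->]]; last by rewrite subrr normr0 addr0.
by rewrite ler_norml; lra.
Qed.

Lemma log_mean_gt0 x z : 0 < x -> 0 < z -> 0 < log_mean x z.
Proof.
move=> x0 z0; rewrite /log_mean; case: eqP => // xz.
case: (ltgtP x z) => // h.
  rewrite -mulrNN -invrN divr_gt0 ?oppr_gt0 ?subr_lt0 //.
  by rewrite ln_lt0 // divr_gt0 //= ltr_pdivrMr // mul1r.
by rewrite divr_gt0 ?subr_gt0 // ln_gt0 // ltr_pdivlMr // mul1r.
Qed.

Lemma log_mean_ge0 x z : flux_pair x z -> 0 <= log_mean x z.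
Proof.
case=> [[x0 z0]|[-> ->]]; first exact/ltW/log_mean_gt0.
by rewrite /log_mean eqxx.
Qed.

(** For [x != z], let [h] be half the log-ratio and [K] the log-mean: then [x + z = 2 K h coth h]
    and [(x - z) ln (x / z) = 4 K h^2], and the bound is [2 K] times [xcoth_tangent] at [y = |h|].
    It is linear in the edge quantities, so it can be summed with a common [s]. *)
Lemma add_le_log_mean x z s : 0 < s -> flux_pair x z ->
  x + z <= 2 * log_mean x z * (s * cosh s / sinh s - xcoth_slope s * s ^+ 2)
           + xcoth_slope s / 2 * ((x - z) * ln (x / z)).
Proof.
move=> s0; case=> [[x0 z0]|[-> ->]]; last first.
  by rewrite /log_mean eqxx subrr !(mulr0, mul0r) addr0.
case: (eqVneq x z) => [<-|xz].
  rewrite /log_mean eqxx subrr mul0r mulr0 addr0 (_ : x + x = 2 * x); last by ring.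
  by rewrite ler_peMr ?mulr_ge0 ?(ltW x0) // xcoth_tangent0.
have K0 := log_mean_gt0 x0 z0.
have eq2 : ln (x / z) = 2 * (ln (x / z) / 2) by field.
have h0 : ln (x / z) / 2 != 0.
  apply: contra_neq xz => h0; apply/eqP; rewrite -subr_eq0 (sub_eq_tanh x0 z0) h0.
  by rewrite tanhE sinh0 mul0r mulr0.
have EK : x - z = 2 * log_mean x z * (ln (x / z) / 2).
  rewrite /log_mean (negbTE xz) {2}eq2; field.
  by move: h0; rewrite mulf_eq0 negb_or => /andP[].
have E := sub_eq_tanh x0 z0; rewrite eq2 EK; rewrite EK in E.
move: h0 E K0; set h := ln _ / 2; set K := log_mean _ _ => h0 E K0.
(* [h coth h] is even, so the tangent bound for positive arguments applies to [|h|]. *)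
have sg : h * cosh h / sinh h = `|h| * cosh `|h| / sinh `|h|.
  case: (ler0P h) => // _.
  by rewrite coshN sinhN invrN mulNr mulrNN.
have sh0 : sinh h != 0.
  case: (ltgtP 0 h) => hh; last by rewrite -hh eqxx in h0.
    by rewrite gt_eqF // sinh_gt0.
  by rewrite -oppr_eq0 -sinhN gt_eqF // sinh_gt0 // oppr_gt0.
have ch0 : cosh h != 0 by rewrite gt_eqF // cosh_gt0.
have -> : x + z = 2 * K * (h * cosh h / sinh h).
  apply: (@mulIf _ (sinh h / cosh h)); first by rewrite mulf_neq0 // invr_eq0.
  by rewrite -tanhE -E tanhE; field; rewrite ch0 sh0.
have -> : 2 * K * (s * cosh s / sinh s - xcoth_slope s * s ^+ 2) +
    xcoth_slope s / 2 * (2 * K * h * (2 * h)) =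
  2 * K * (s * cosh s / sinh s + xcoth_slope s * (`|h| ^+ 2 - s ^+ 2)).
  by rewrite real_normK ?num_real //; field; rewrite gt_eqF // sinh_gt0.
rewrite ler_pM2l ?mulr_gt0 // sg xcoth_tangent //.
by rewrite normr_gt0.
Qed.

(** * Summation over the edges *)

Section Sums.
Variables (I : finType) (P : pred I) (x z : I -> R).
Hypothesis xz : forall i, P i -> flux_pair (x i) (z i).

(** [S], [G] and [K] will be sigma, gamma and kappa; [A] is the total absolute current. *)
Let S := \sum_(i | P i) (x i - z i) * ln (x i / z i).
Let G := \sum_(i | P i) (x i + z i).
Let K := \sum_(i | P i) log_mean (x i) (z i).
Let A := \sum_(i | P i) `|x i - z i|.

Let S_ge0 : 0 <= S.
Proof. by apply: sumr_ge0 => i /xz; exact: sub_ln_ge0. Qed.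

Let A_ge0 : 0 <= A.
Proof. by apply: sumr_ge0 => i _. Qed.

Let AG : A <= G.
Proof. by apply: ler_sum => i /xz; exact: abs_sub_le. Qed.

(** Edges with zero fluxes add nothing to [S]; the edge found here makes [G] and [K] positive. *)
Let S_gt0_fluxes : 0 < S -> exists2 i, P i & 0 < x i /\ 0 < z i.
Proof.
move=> S0; apply: contrapT => H; move: S0.
rewrite /S big1 ?ltxx // => i Pi; case: (xz Pi) => [xz0|[-> ->]].
  by exfalso; apply: H; exists i.
by rewrite subrr mul0r.
Qed.

Let G_gt0 : 0 < S -> 0 < G.
Proof.
move=> /S_gt0_fluxes[i Pi [x0 z0]]; rewrite /G (bigD1 i) //=.
apply: ltr_wpDr; last exact: addr_gt0.
apply: sumr_ge0 => j /andP[/xz + _].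
by case=> [[xj zj]|[-> ->]]; rewrite ?addr0 // addr_ge0 ?ltW.
Qed.

Let K_gt0 : 0 < S -> 0 < K.
Proof.
move=> /S_gt0_fluxes[i Pi [x0 z0]]; rewrite /K (bigD1 i) //=.
apply: ltr_wpDr; last exact: log_mean_gt0.
by apply: sumr_ge0 => j /andP[/xz + _]; exact: log_mean_ge0.
Qed.

(** Cauchy-Schwarz in discriminant form: the quadratic [2 G u^2 - 4 A u + S] is nonnegative for
    every [u]. *)
Lemma sum_abs_sub_sqr_le : 2 * A ^+ 2 <= G * S.
Proof.
have [G0|G0] := leP G 0.
  have A0 : A = 0 by apply/eqP; rewrite eq_le A_ge0 andbT (le_trans AG).
  have -> : G = 0 by apply/eqP; rewrite eq_le G0 (le_trans A_ge0 AG).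
  by rewrite A0 expr0n mulr0 mul0r.
have H u : 4 * u * A <= 2 * u ^+ 2 * G + S.
  rewrite /A /G /S !mulr_sumr -big_split /=.
  by apply: ler_sum => i /xz; exact: abs_sub_le_ln.
(* [A / G] is the minimizer of the quadratic. *)
have := H (A / G); rewrite -(ler_pM2l G0) -subr_ge0.
have -> : G * (2 * (A / G) ^+ 2 * G + S) - G * (4 * (A / G) * A) =
  G * S - 2 * A ^+ 2 by field; rewrite gt_eqF.
by rewrite subr_ge0.
Qed.

Lemma sum_abs_sub_le_Phi : A <= S / Phi (S / (2 * G)).
Proof.
have [S0|S0] := leP S 0.
  (* At [S = 0] the right-hand side is 0, and the quadratic bound forces [A = 0]. *)
  have SE : S = 0 by apply/eqP; rewrite eq_le S0 S_ge0.
  have := sum_abs_sub_sqr_le; rewrite SE mul0r mulr0 => H.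
  have : A ^+ 2 <= 0 by rewrite -(@ler_pM2l _ 2) // mulr0.
  by rewrite real_exprn_even_le0 ?num_real //= => /eqP ->.
have G0 := G_gt0 S0.
have q0 : 0 < S / (2 * G) by rewrite divr_gt0 // mulr_gt0.
have [A0|A0] := leP A 0.
  by apply: le_trans A0 _; rewrite divr_ge0 ?(ltW S0) // ltW // Phi_gt0.
rewrite ler_pdivlMr ?Phi_gt0 // mulrC -ler_pdivlMr //.
have z0 : 0 < S / A by rewrite divr_gt0.
apply: Phi_le; rewrite ?(ltW q0) ?(ltW z0) //.
apply: le_trans (_ : S / A * (S / A / (1 + S / A)) <= _); last first.
  by rewrite ler_wpM2l ?tanh_ge ?(ltW z0).
have -> : S / A * (S / A / (1 + S / A)) = S ^+ 2 / (A * (A + S)).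
  by field; rewrite !gt_eqF // ?addr_gt0.
rewrite ler_pdivrMr ?mulr_gt0 // mulrAC ler_pdivlMr ?mulr_gt0 ?addr_gt0 //.
rewrite expr2 -mulrA ler_pM2l //.
(* What remains is [A (A + S) <= 2 G S], from [2 A^2 <= G S] and [A <= G]. *)
have := sum_abs_sub_sqr_le; have : A * S <= G * S by rewrite ler_pM2r.
have := mulr_gt0 G0 S0.
nra.
Qed.

Lemma Phi_le_sqrt : S / Phi (S / (2 * G)) <= 2 * Num.sqrt (S * K).
Proof.
have [S0|S0] := leP S 0.
  have -> : S = 0 by apply/eqP; rewrite eq_le S0 S_ge0.
  by rewrite !mul0r sqrtr0 mulr0.
have G0 := G_gt0 S0; have K0 := K_gt0 S0.
have q0 : 0 < S / (2 * G) by rewrite divr_gt0 // mulr_gt0.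
(* Chosen so that [S = 4 K s^2]: the slope terms of the summed tangent bound then cancel, leaving
   [G <= 2 K s coth s]. *)
pose s := Num.sqrt (S / K) / 2.
have s0 : 0 < s by rewrite divr_gt0 // sqrtr_gt0 divr_gt0.
have SE : S = 4 * K * s ^+ 2.
  rewrite /s expr_div_n sqr_sqrtr ?divr_ge0 ?(ltW S0) ?(ltW K0) //.
  by field; rewrite gt_eqF.
have Ks0 : 0 < 2 * K * s := mulr_gt0 (mulr_gt0 (ltr0Sn _ 1) K0) s0.
have -> : Num.sqrt (S * K) = 2 * K * s.
  rewrite SE (_ : _ * K = (2 * K * s) ^+ 2); last by ring.
  by rewrite sqrtr_sqr gtr0_norm.
have GK : G <= 2 * K * (s * cosh s / sinh s).
  have -> : 2 * K * (s * cosh s / sinh s) =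
    2 * K * (s * cosh s / sinh s - xcoth_slope s * s ^+ 2) + xcoth_slope s / 2 * S.
    by rewrite SE; field; rewrite gt_eqF // sinh_gt0.
  rewrite /G /K /S (mulrAC 2) !mulr_sumr -big_split /=.
  apply: ler_sum => i /xz /(add_le_log_mean s0).
  by rewrite (mulrAC 2).
(* [2 G s tanh s] is at most [4 K s coth s] times [s tanh s], which is [4 K s^2 = S]. *)
have sPhi : s <= Phi (S / (2 * G)).
  apply: Phi_ge; rewrite ?(ltW s0) ?(ltW q0) //.
  rewrite ler_pdivlMr ?mulr_gt0 //.
  apply: le_trans (_ : s * tanh s * (2 * (2 * K * (s * cosh s / sinh s))) <= _).
    by rewrite ler_pM2l ?ler_pM2l // mulr_gt0 // tanh_gt0.
  rewrite tanhE SE le_eqVlt; apply/orP; left; apply/eqP; field.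
  by rewrite !gt_eqF ?sinh_gt0 ?cosh_gt0.
rewrite ler_pdivrMr ?Phi_gt0 //.
apply: le_trans (_ : 2 * (2 * K * s) * s <= _).
  by rewrite le_eqVlt SE; apply/orP; left; apply/eqP; ring.
by rewrite ler_wpM2l // mulr_ge0 // ltW.
Qed.

End Sums.
End Fluxes.

(** * The complex exponential: series and mean value bound *)

Section ComplexExponential.
Context {R : realType}.
Implicit Types (c z w : R[i]) (t : R).

Lemma Re_normc_le z : `|complex.Re z| <= Normc.normc z.
Proof.
case: z => a b /=; rewrite -sqrtr_sqr ler_wsqrtr // lerDl sqr_ge0 //.
Qed.

Lemma normcX z k : Normc.normc (z ^+ k) = Normc.normc z ^+ k.
Proof.
elim: k => [|k IH]; first by rewrite !expr0 Normc.normc1.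
by rewrite !exprS Normc.normcM IH.
Qed.

Lemma normc_ge0 z : 0 <= Normc.normc z.
Proof. by case: z => a b /=; exact: sqrtr_ge0. Qed.

(** The polar form makes modulus and conjugate explicit; [cvg_cexp] identifies it with the
    exponential series. *)
Definition cexp z : R[i] :=
  (expR (complex.Re z) * cos (complex.Im z))
  +i* (expR (complex.Re z) * sin (complex.Im z)).

(** Multiplying by [c] before taking real parts yields real power series that also reach the
    imaginary part, up to sign, through [c = 'i]. *)
Let coef c z (k : nat) : R := complex.Re (c * z ^+ k) / k`!%:R.

Let is_cvg_coef c z t : cvgn (pseries (coef c z) t).
Proof.
apply: normed_cvg.
have Hc := @is_cvg_seriesZ _ _ (Normc.normc c)
  (is_cvg_series_exp_coeff (Normc.normc z * `|t|)).
apply: series_le_cvg Hc => [k|k|k] /=; first by [].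
  by rewrite mulr_ge0 ?normc_ge0 // divr_ge0 ?exprn_ge0 // mulr_ge0 ?normc_ge0.
rewrite /coef !normrM normfV normr_nat normrX.
apply: le_trans (_ : Normc.normc c * Normc.normc z ^+ k / k`!%:R * `|t| ^+ k <= _).
  rewrite ler_wpM2r ?exprn_ge0 // ler_wpM2r ?invr_ge0 //.
  by rewrite -normcX -Normc.normcM Re_normc_le.
rewrite fctE /exp_coeff /= exprMn le_eqVlt; apply/orP; left; apply/eqP.
by rewrite /GRing.scale /=; ring.
Qed.

(** Term-by-term differentiation multiplies [c] by [z], so the family of series is closed under
    derivation. *)
Let diffs_coef c z : pseries_diffs (coef c z) = coef (c * z) z.
Proof.
apply/funext => k; rewrite /pseries_diffs /coef factS natrM invfM exprS mulrA.
by rewrite mulrCA mulVKf ?pnatr_eq0.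
Qed.

Let f c z t := limn (pseries (coef c z) t).

Let is_derive_f c z t : is_derive t 1 (f c z) (f (c * z) z t).
Proof.
rewrite /f -diffs_coef; apply: (@pseries_snd_diffs _ _ (`|t| + 1)).
- exact: is_cvg_coef.
- by rewrite diffs_coef; exact: is_cvg_coef.
- by rewrite !diffs_coef; exact: is_cvg_coef.
- by rewrite [ltRHS]ger0_norm ?addr_ge0 // ltrDl.
Qed.

Let f_linear c z t :
  f c z t = complex.Re c * f 1 z t + complex.Im c * f 'i z t.
Proof.
apply/cvg_lim => //.
have H1 := @is_cvg_coef 1 z t; have Hi := @is_cvg_coef 'i z t.
have -> : pseries (coef c z) t =
  (complex.Re c \*o pseries (coef 1 z) t) + (complex.Im c \*o pseries (coef 'i z) t).
  apply/funext => N; rewrite fctE /= /pseries /series /= !mulr_sumr -big_split /=.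
  apply: eq_bigr => k _; rewrite /coef.
  by case: c (z ^+ k) => [a b] [x y] /=; ring.
by apply: cvgD; apply: cvgMr.
Qed.

Let f0 c z : f c z 0 = complex.Re c.
Proof.
apply: lim_near_cst => //; near=> N.
rewrite /pseries /series /= -[N]prednK; last by near: N.
rewrite big_nat_recl //= big1 ?addr0.
  by rewrite /coef !expr0 !mulr1 fact0 divr1.
by move=> k _; rewrite expr0n /= mulr0.
Unshelve. all: by end_near. Qed.

(* [f 1 z] and [f 'i z] solve the linear system of [Re (expR (t z))] and
   [- Im (expR (t z))]; rotating them back gives constant functions. *)
Lemma cvg_cexp c z :
  (series (fun k => complex.Re (c * z ^+ k) / k`!%:R) @ \oo --> complex.Re (c * cexp z))%classic.
Proof.
have fE : complex.Re (c * cexp z) = f c z 1.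
  pose x := complex.Re z; pose y := complex.Im z.
  pose C t := expR (- x * t) * (cos (y * t) * f 1 z t - sin (y * t) * f 'i z t).
  pose S t := expR (- x * t) * (sin (y * t) * f 1 z t + cos (y * t) * f 'i z t).
  have d1 t : is_derive t 1 (f 1 z) (x * f 1 z t + y * f 'i z t).
    by have := is_derive_f 1 z t; rewrite mul1r [f z z t]f_linear.
  have di t : is_derive t 1 (f 'i z) (- y * f 1 z t + x * f 'i z t).
    have := is_derive_f 'i z t; rewrite [f ('i * z) z t]f_linear.
    by rewrite /x /y; case: (z) => a b /=; rewrite !(mul0r, mul1r, sub0r, add0r, addr0).
  have de t : is_derive t 1 (fun t => expR (- x * t)) (- x * expR (- x * t)).
    by apply: is_derive_eq; rewrite /GRing.scale /=; ring.
  have dc t : is_derive t 1 (fun t => cos (y * t)) (- y * sin (y * t)).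
    by apply: is_derive_eq; rewrite /GRing.scale /=; ring.
  have ds t : is_derive t 1 (fun t => sin (y * t)) (y * cos (y * t)).
    by apply: is_derive_eq; rewrite /GRing.scale /=; ring.
  have dC t : is_derive t 1 C 0.
    by rewrite /C; apply: is_derive_eq; rewrite /GRing.scale /=; ring.
  have dS t : is_derive t 1 S 0.
    by rewrite /S; apply: is_derive_eq; rewrite /GRing.scale /=; ring.
  have C1 : C 1 = 1.
    rewrite (is_derive_0_is_cst 1 0 dC) /C !mulr0 expR0 cos0 sin0 !f0 /=.
    by rewrite !(mul0r, mul1r, subr0).
  have S1 : S 1 = 0.
    rewrite (is_derive_0_is_cst 1 0 dS) /S !mulr0 expR0 cos0 sin0 !f0 /=.
    by rewrite !(mul0r, mul1r, addr0, mulr0).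
  have ee : expR x * expR (- x) = 1 by exact: expRxMexpNx_1.
  have cs := cos2Dsin2 y.
  move: C1 S1; rewrite /C /S !mulr1 => C1 S1.
  have f1 : f 1 z 1 = expR x * cos y.
    transitivity (expR x * expR (- x) * (cos y ^+ 2 + sin y ^+ 2) * f 1 z 1).
      by rewrite ee cs !mul1r.
    transitivity (expR x * (cos y * (expR (- x) * (cos y * f 1 z 1 - sin y * f 'i z 1))
       + sin y * (expR (- x) * (sin y * f 1 z 1 + cos y * f 'i z 1)))); first ring.
    by rewrite C1 S1; ring.
  have fi : f 'i z 1 = - (expR x * sin y).
    transitivity (expR x * expR (- x) * (cos y ^+ 2 + sin y ^+ 2) * f 'i z 1).
      by rewrite ee cs !mul1r.
    transitivity (expR x * (- sin y * (expR (- x) * (cos y * f 1 z 1 - sin y * f 'i z 1))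
       + cos y * (expR (- x) * (sin y * f 1 z 1 + cos y * f 'i z 1)))); first ring.
    by rewrite C1 S1; ring.
  rewrite f_linear f1 fi /cexp -/x -/y; case: (c) => a b /=; ring.
rewrite fE.
have -> : series (fun k => complex.Re (c * z ^+ k) / k`!%:R) = pseries (coef c z) 1.
  by rewrite /pseries; congr series; apply/funext => k /=; rewrite expr1n mulr1.
exact: is_cvg_coef.
Qed.

Lemma cexp0 : cexp 0 = 1.
Proof. by rewrite /cexp /= expR0 cos0 sin0 mulr1 mulr0. Qed.

Lemma cexpJ z : cexp (z^*)%C = (cexp z)^*%C.
Proof. by case: z => x y; rewrite /cexp /= cosN sinN mulrN. Qed.

Lemma onem_cos_le t : 1 - cos t <= t ^+ 2 / 2.
Proof.
have sin_le (u : R) : 0 <= u -> sin u <= u.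
  move=> u0; rewrite -subr_ge0.
  have -> : 0 = 0 - sin 0 :> R by rewrite sin0 subr0.
  by apply: (@is_derive_nondecreasing _ (fun u => u - sin u) (fun u => 1 - cos u)) => // v _;
    rewrite subr_ge0 cos_le1.
rewrite -cos_norm -(real_normK (num_real t)) -subr_ge0.
have -> : 0 = 0 ^+ 2 / 2 - (1 - cos 0) :> R by rewrite cos0 subrr expr0n mul0r subr0.
apply: (@is_derive_nondecreasing _ (fun u => u ^+ 2 / 2 - (1 - cos u)) (fun u => u - sin u)) => //.
  by move=> u _; apply: is_derive_eq; rewrite /GRing.scale /=; field.
by move=> u /andP[u0 _]; rewrite subr_ge0 sin_le.
Qed.

(** By the law of cosines the squared distance is [(expR x1 - expR x2)^2 + 2 expR (x1 + x2) (1 - cos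
    (y1 - y2))]; the radial and angular parts are bounded separately. *)
Lemma normc_cexpB_le z w (m : R) : complex.Re z <= m -> complex.Re w <= m ->
  Normc.normc (cexp z - cexp w) <= expR m * Normc.normc (z - w).
Proof.
case: z w => [x1 y1] [x2 y2] /= h1 h2.
have eD (u v : R) : u <= m -> v <= u -> 0 <= expR u - expR v <= expR m * (u - v).
  move=> um vu; rewrite subr_ge0 ler_expR vu /=.
  have -> : expR v = expR u * expR (v - u) by rewrite -expRD addrC subrK.
  have := expR_ge1Dx (v - u); have : expR u <= expR m by rewrite ler_expR.
  have := expR_gt0 u; nra.
have eD2 : (expR x1 - expR x2) ^+ 2 <= (expR m) ^+ 2 * (x1 - x2) ^+ 2.
  rewrite -exprMn.
  case: (leP x2 x1) => [/(eD _ _ h1)/andP[d0 d1]|/ltW/(eD _ _ h2)/andP[d0 d1]].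
    by rewrite ler_sqr ?nnegrE // (le_trans d0).
  rewrite -sqrrN opprB -[leRHS]sqrrN -mulrN opprB.
  by rewrite ler_sqr ?nnegrE // (le_trans d0).
have M0 := expR_gt0 m.
rewrite -[expR m]gtr0_norm // -sqrtr_sqr -sqrtrM ?sqr_ge0 // ler_wsqrtr //.
have -> : (expR x1 * cos y1 - expR x2 * cos y2) ^+ 2 +
  (expR x1 * sin y1 - expR x2 * sin y2) ^+ 2 =
  (expR x1 - expR x2) ^+ 2 + 2 * (expR x1 * expR x2) * (1 - cos (y1 - y2)).
  rewrite cosB.
  transitivity (expR x1 ^+ 2 * (cos y1 ^+ 2 + sin y1 ^+ 2) +
    expR x2 ^+ 2 * (cos y2 ^+ 2 + sin y2 ^+ 2) -
    2 * expR x1 * expR x2 * (cos y1 * cos y2 + sin y1 * sin y2)); first ring.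
  by rewrite !cos2Dsin2; ring.
rewrite [leRHS]mulrDr; apply: lerD => //.
have e12 : expR x1 * expR x2 <= expR m ^+ 2.
  by rewrite expr2 ler_pM ?expR_ge0 // ler_expR.
have := onem_cos_le (y1 - y2).
have : 0 < expR x1 * expR x2 by rewrite mulr_gt0 ?expR_gt0.
have := sqr_ge0 (y1 - y2).
nra.
Qed.

End ComplexExponential.

(** * Exponential of a diagonalizable real matrix *)

Section MatrixExponential.
Context {R : realType}.

Lemma cvg_mx_coord (m n : nat) (u : nat -> 'M[R]_(m, n)) (L : 'M[R]_(m, n)) :
  (forall i j, (u k i j @[k --> \oo] --> L i j)%classic) ->
  (u k @[k --> \oo] --> L)%classic.
Proof.
move=> uL A [Q HQ QA].
have H : (\forall k \near \oo, forall i j, Q i j (u k i j))%classic.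
  by apply: filter_forall => i; apply: filter_forall => j; exact: uL (HQ i j).
by apply: filterS H => k Hk; exact: QA.
Qed.

Lemma complex_mxX (n : nat) (A : 'M[R]_n.+1) k :
  complex_mx (A ^+ k) = complex_mx A ^+ k.
Proof. exact: rmorphXn. Qed.

Lemma complex_mxM (m n p : nat) (A : 'M[R]_(m, n)) (B : 'M[R]_(n, p)) :
  complex_mx (A *m B) = complex_mx A *m complex_mx B.
Proof. exact: map_mxM. Qed.

Lemma left_diag_mxX (n : nat) (A : 'M[R]_n.+1) (P : 'M[R[i]]_n.+1)
    (mu : 'rV[R[i]]_n.+1) k :
  P *m complex_mx A = diag_mx mu *m P ->
  P *m complex_mx (A ^+ k) = diag_mx (map_mx (fun z => z ^+ k) mu) *m P.
Proof.
move=> PA; rewrite complex_mxX; elim: k => [|k IH].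
  rewrite expr0 mulmx1 (_ : map_mx _ mu = const_mx 1) ?diag_const_mx ?mul1mx //.
  by apply/rowP => i; rewrite !mxE expr0.
rewrite exprSr -mulmxE mulmxA IH -mulmxA PA mulmxA mulmx_diag.
by congr (diag_mx _ *m _); apply/rowP => i; rewrite !mxE exprSr.
Qed.

(** The entries of [A ^+ k] are combinations of the [mu 0 l ^+ k] with coefficients independent of
    [k], so the matrix series reduces entrywise to scalar exponential series. *)
Lemma expmx_diag (n : nat) (A : 'M[R]_n.+1) (P P' : 'M[R[i]]_n.+1)
    (mu : 'rV[R[i]]_n.+1) :
  P' *m P = 1%:M -> P *m complex_mx A = diag_mx mu *m P ->
  P *m complex_mx (expmx A) = diag_mx (map_mx cexp mu) *m P.
Proof.
move=> P'P PA.
pose c i j l := P' i l * P l j.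
pose L := P' *m (diag_mx (map_mx cexp mu) *m P).
have LE i j : L i j = \sum_l c i j l * cexp (mu 0 l).
  by rewrite /L mul_diag_mx mxE; apply: eq_bigr => l _; rewrite !mxE /c; ring.
have AE k i j : ((A ^+ k) i j)%:C = \sum_l c i j l * mu 0 l ^+ k.
  transitivity (complex_mx (A ^+ k) i j); first by rewrite mxE.
  rewrite -[complex_mx _]mul1mx -P'P -mulmxA (left_diag_mxX _ PA) mul_diag_mx mxE.
  by apply: eq_bigr => l _; rewrite !mxE /c; ring.
(* [d = 1] gives the limit of the real series, and [d = 'i] shows that [L] is real. *)
have cvgL (d : R[i]) i j :
  (series (fun k => complex.Re (d * ((A ^+ k) i j)%:C) / k`!%:R) @ \oo -->
   complex.Re (d * L i j))%classic.
  have -> : series (fun k => complex.Re (d * ((A ^+ k) i j)%:C) / k`!%:R) =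
      (fun N => \sum_l series (fun k => complex.Re (d * c i j l * mu 0 l ^+ k) / k`!%:R) N).
    apply/funext => N; rewrite /series /= exchange_big /=.
    apply: eq_bigr => k _; rewrite AE mulr_sumr raddf_sum /= mulr_suml.
    by apply: eq_bigr => l _; rewrite mulrA.
  rewrite LE mulr_sumr raddf_sum /=.
  under [X in (_ --> X)%classic]eq_bigr do rewrite mulrA.
  by apply: cvg_big => [|l _]; [exact: add_continuous | exact: cvg_cexp].
have ReL i j : (series (fun k => k`!%:R^-1 * (A ^+ k) i j) @ \oo -->
    complex.Re (L i j))%classic.
  have := @cvgL 1 i j; rewrite mul1r.
  under [X in series X]eq_fun do rewrite mul1r mulrC.
  exact.
have ImL i j : complex.Im (L i j) = 0.
  have := @cvgL 'i i j; have -> : complex.Re ('i * L i j) = - complex.Im (L i j).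
    by case: (L i j) => a b /=; ring.
  have -> : series (fun k => complex.Re ('i * ((A ^+ k) i j)%:C) / k`!%:R) = fun=> 0.
    apply/funext => N; rewrite /series /= big1 // => k _.
    by rewrite !(mul0r, mulr0, subrr).
  move=> /(cvg_unique _ (cvg_cst _)) /= /(_ (@norm_hausdorff _ _)) /eqP.
  by rewrite eq_sym oppr_eq0 => /eqP.
have expE : expmx A = map_mx (@complex.Re R) L.
  apply: cvg_lim; first exact: norm_hausdorff.
  apply: cvg_mx_coord => i j; rewrite mxE.
  have -> : (fun N => series (fun k => k`!%:R^-1 *: A ^+ k) N i j) =
      series (fun k => k`!%:R^-1 * (A ^+ k) i j); last exact: ReL.
  apply/funext => N; rewrite /series /= summxE.
  by apply: eq_bigr => k _; rewrite mxE.
have -> : complex_mx (expmx A) = L.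
  apply/matrixP => i j; transitivity (complex.Re (L i j))%:C.
    by rewrite expE !mxE.
  by have := ImL i j; case: (L i j) => a b /= ->.
by rewrite /L mulmxA (mulmx1C P'P) mul1mx.
Qed.

End MatrixExponential.

(** * Moduli, conjugate transposes and sums over pairs *)

Section Norms.
Local Open Scope sesquilinear_scope.
Context {R : realType}.

Lemma normc_sum_le (I : Type) (r : seq I) (P : pred I) (F : I -> R[i]) :
  Normc.normc (\sum_(i <- r | P i) F i) <= \sum_(i <- r | P i) Normc.normc (F i).
Proof.
elim/big_rec2: _ => [|i y x _ IH]; first by rewrite Normc.normc0.
by apply: le_trans (le_normcD _ _) _; rewrite lerD2l.
Qed.

Lemma normcJ (z : R[i]) : Normc.normc (z^*)%C = Normc.normc z.
Proof. by case: z => a b /=; rewrite sqrrN. Qed.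

Lemma normc_real (x : R) : Normc.normc x%:C = `|x|.
Proof. by rewrite /= expr0n addr0 sqrtr_sqr. Qed.

Lemma sum_pairs (n : nat) (F : 'I_n -> 'I_n -> R) :
  (forall i, F i i = 0) ->
  \sum_i \sum_j F i j = \sum_(i < n) \sum_(j < n | (j < i)%N) (F i j + F j i).
Proof.
move=> F0.
under [RHS]eq_bigr do rewrite big_split /=.
rewrite big_split /= [X in _ + X](exchange_big_dep xpredT) //= -big_split /=.
apply: eq_bigr => i _.
rewrite (bigID (fun j : 'I_n => (j < i)%N)) /=; congr (_ + _).
rewrite (bigID (fun j : 'I_n => j == i)) /= [X in X + _]big1 ?add0r => [|j /andP[_ /eqP ->] //].
by apply: eq_bigl => j; rewrite -leqNgt ltn_neqAle eq_sym andbC.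
Qed.

Lemma trmxC_mul (m n p : nat) (A : 'M[R[i]]_(m, n)) (B : 'M[R[i]]_(n, p)) :
  (A *m B)^t* = B^t* *m A^t*.
Proof. by rewrite trmx_mul map_mxM. Qed.

Lemma complex_mxT (m n : nat) (A : 'M[R]_(m, n)) :
  complex_mx A^T = (complex_mx A)^t*.
Proof. by apply/matrixP => i j; rewrite !mxE; apply/esym/conjc_real. Qed.

Lemma complex_mxB (m n : nat) (A B : 'M[R]_(m, n)) :
  complex_mx (A - B) = complex_mx A - complex_mx B.
Proof. exact: map_mxB. Qed.

End Norms.

(** * Correlations in the basis of left eigenvectors *)

Section EigenvectorBasis.
Local Open Scope sesquilinear_scope.
Context {R : realType} {n : nat}.
Variables (W : 'M[R]_n.+2) (p : 'cV[R]_n.+2) (lam : 'I_n.+2 -> R[i])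
  (v : n.+2.-tuple 'cV[R[i]]_n.+2).
Hypothesis hspec : spectral_assumptions W lam v.

Definition eigenmx : 'M[R[i]]_n.+2 := \matrix_(i, l) tnth v l i 0.
Definition coords (z : 'cV[R[i]]_n.+2) : 'cV[R[i]]_n.+2 := \col_k coord v k z.

(** The matrix [Q] of the opening overview. *)
Definition gram : 'M[R[i]]_n.+2 :=
  eigenmx^t* *m complex_mx (diag_mx p^T) *m eigenmx.

Definition currentmx : 'M[R]_n.+2 := \matrix_(m, k) current W p m k.

Lemma eigenmx_coords z : eigenmx *m coords z = z.
Proof.
rewrite [RHS](coord_basis (eigenvector_basis hspec) (memvf z)).
apply/colP => i; rewrite summxE mxE; apply: eq_bigr => l _.
by rewrite !mxE (tnth_nth 0) mulrC.
Qed.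

(** The coordinates of the standard basis vectors are the columns of the inverse of [eigenmx]. *)
Lemma eigenmx_inv : exists P' : 'M[R[i]]_n.+2, P' *m eigenmx^t* = 1%:M.
Proof.
pose V' : 'M[R[i]]_n.+2 := \matrix_(k, j) coords (delta_mx j 0) k 0.
exists (V' ^t*); rewrite -trmxC_mul (_ : eigenmx *m V' = 1%:M) ?trmx1 ?map_mx1 //.
apply/matrixP => i j.
transitivity ((eigenmx *m coords (delta_mx j 0)) i 0).
  by rewrite !mxE; apply: eq_bigr => l _; rewrite !mxE.
by rewrite eigenmx_coords !mxE eqxx andbT.
Qed.

Lemma eigenmx_left_eigen :
  eigenmx^t* *m complex_mx W = diag_mx (\row_l lam l) *m eigenmx^t*.
Proof.
apply/matrixP => l j; rewrite mul_diag_mx !mxE.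
have /matrixP/(_ 0 j) := left_eigenvectors hspec l; rewrite !mxE => <-.
by apply: eq_bigr => i _; rewrite !mxE.
Qed.

Lemma gram_hermitian : gram^t* = gram.
Proof.
by rewrite /gram !trmxC_mul trmxCK -complex_mxT tr_diag_mx mulmxA.
Qed.

Lemma cross_correlation_gram (a b : 'cV[R]_n.+2) (tau : R) :
  complex_mx (b^T *m expmx (tau *: W) *m diag_mx p^T *m a) =
  (coords (complex_mx b))^t* *m diag_mx (\row_l cexp (tau%:C * lam l)) *m gram
    *m coords (complex_mx a).
Proof.
have [P' P'P] := eigenmx_inv.
have E : eigenmx^t* *m complex_mx (expmx (tau *: W)) =
    diag_mx (\row_l cexp (tau%:C * lam l)) *m eigenmx^t*.
  rewrite (expmx_diag (mu := \row_l (tau%:C * lam l)) P'P).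
    by congr (diag_mx _ *m _); apply/rowP => l; rewrite !mxE.
  have -> : complex_mx (tau *: W) = tau%:C *: complex_mx W by exact: map_mxZ.
  rewrite -scalemxAr eigenmx_left_eigen scalemxAl; congr (_ *m _).
  by apply/matrixP => i j; rewrite !mxE mulrnAr.
rewrite !complex_mxM complex_mxT -{1}(eigenmx_coords (complex_mx b)).
rewrite -{1}(eigenmx_coords (complex_mx a)) trmxC_mul -(mulmxA _ _ (complex_mx (expmx _))).
by rewrite E /gram !mulmxA.
Qed.

(** The correlation [C_ab] is real, hence its own conjugate transpose; as [gram] is Hermitian, this
    moves the exponential, conjugated, to the right of [gram]. *)
Lemma correlation_asymmetry_gram (a b : 'cV[R]_n.+2) (tau : R) :
  (correlation_asymmetry W p b a tau)%:C =
  \sum_k \sum_l (coord v l (complex_mx b))^*%C *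
    ((cexp (tau%:C * lam l) - (cexp (tau%:C * lam k))^*%C) * gram l k) *
    coord v k (complex_mx a).
Proof.
have CC := cross_correlation_gram; move: CC gram_hermitian.
move: gram => Q CC QH; pose D := diag_mx (\row_l cexp (tau%:C * lam l)).
have -> : (correlation_asymmetry W p b a tau)%:C =
    ((coords (complex_mx b))^t* *m (D *m Q - Q *m D^t*) *m
      coords (complex_mx a)) 0 0.
  rewrite mulmxBr mulmxBl !mulmxA [RHS]mxE [X in _ = _ + X]mxE /D -CC.
  have -> : (coords (complex_mx b))^t* *m Q *m D^t* *m coords (complex_mx a) =
      (complex_mx (a^T *m expmx (tau *: W) *m diag_mx p^T *m b))^t*.
    by rewrite CC !trmxC_mul trmxCK QH !mulmxA.
  rewrite -complex_mxT /correlation_asymmetry /cross_correlation rmorphB /=.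
  by congr (_ - _); rewrite [RHS]mxE // [in RHS]mxE.
rewrite mxE; apply: eq_bigr => k _; rewrite mxE mulr_suml.
apply: eq_bigr => l _; rewrite [coords _ _ _]mxE; congr (_ * _).
rewrite [(coords _)^t* _ _]mxE [(coords _)^T _ _]mxE [coords _ _ _]mxE; congr (_ * _).
rewrite mxE [X in _ + X = _]mxE /D mul_diag_mx mxE tr_diag_mx map_diag_mx mul_mx_diag.
rewrite !mxE mulrBl; congr (_ - _).
by rewrite mulrC.
Qed.

End EigenvectorBasis.

(** Serves [W Pi - Pi W^T], the current matrix: the eigenvector relations act on its two terms from
    opposite sides. *)
Lemma mulmx_intertwine (T : comPzRingType) (m : nat) (P V A B D S X : 'M[T]_m) :
  P *m A = D *m P -> B *m V = V *m S ->
  P *m (A *m X - X *m B) *m V = D *m (P *m X *m V) - (P *m X *m V) *m S.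
Proof.
move=> PA BV; rewrite mulmxBr mulmxBl; congr (_ - _); first by rewrite !mulmxA PA.
by rewrite -!mulmxA BV.
Qed.

(** * The current matrix and the bound on the asymmetry *)

Section Currents.
Local Open Scope sesquilinear_scope.
Context {R : realType} {n : nat}.
Variables (W : 'M[R]_n.+2) (p : 'cV[R]_n.+2) (lam : 'I_n.+2 -> R[i])
  (v : n.+2.-tuple 'cV[R[i]]_n.+2).
Hypothesis hspec : spectral_assumptions W lam v.

Lemma currentC m k : current W p k m = - current W p m k.
Proof. by rewrite /current opprB. Qed.

Lemma currentmxE : currentmx W p = W *m diag_mx p^T - diag_mx p^T *m W^T.
Proof.
apply/matrixP => m k; rewrite mul_mx_diag mul_diag_mx !mxE /current /flux.
by congr (_ - _); rewrite mulrC.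
Qed.

Lemma gram_current l k :
  (lam l - (lam k)^*%C) * gram p v l k =
  ((eigenmx v)^t* *m complex_mx (currentmx W p) *m eigenmx v) l k.
Proof.
have PW := eigenmx_left_eigen hspec; pose D := diag_mx (\row_l lam l).
have WV : (complex_mx W)^t* *m eigenmx v = eigenmx v *m D^t*.
  by rewrite -[in LHS](trmxCK (eigenmx v)) -trmxC_mul PW trmxC_mul trmxCK.
transitivity ((D *m gram p v - gram p v *m D^t*) l k).
  move: (gram p v) => Q; rewrite [RHS]mxE [X in _ = _ + X]mxE.
  rewrite mul_diag_mx tr_diag_mx map_diag_mx mul_mx_diag !mxE mulrBl; congr (_ - _).
  by rewrite mulrC.
congr (fun_of_matrix _ l k); apply/esym.
rewrite currentmxE complex_mxB !complex_mxM complex_mxT.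
exact: mulmx_intertwine.
Qed.

Lemma current_form l k :
  ((eigenmx v)^t* *m complex_mx (currentmx W p) *m eigenmx v) l k =
  \sum_j \sum_i (tnth v l i 0)^*%C * (current W p i j)%:C * tnth v k j 0.
Proof.
rewrite mxE; apply: eq_bigr => j _; rewrite mxE mulr_suml.
by apply: eq_bigr => i _; rewrite !mxE.
Qed.

Lemma sum_normc_sqr l : \sum_i Normc.normc (tnth v l i 0) ^+ 2 = 1.
Proof.
apply: (@complexI R); rewrite rmorph_sum /=.
have /matrixP/(_ 0 0) := unit_eigenvectors hspec l; rewrite mxE [RHS]mxE eqxx => vv.
rewrite -[RHS]/(1 : R[i]) -[RHS]vv.
apply: eq_bigr => i _; rewrite !mxE.
case: (tnth v l i 0) => a b; rewrite /= sqr_sqrtr ?addr_ge0 ?sqr_ge0 //.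
by apply/eqP; rewrite eq_complex /=; apply/andP; split; apply/eqP; ring.
Qed.

(** By antisymmetry of the current, the entries [i j] and [j i] together weigh
    [x i * y j + x j * y i], at most 1 because the eigenvectors are unit vectors. *)
Lemma normc_current_form_le l k :
  Normc.normc (((eigenmx v)^t* *m complex_mx (currentmx W p) *m eigenmx v) l k)
  <= \sum_(i < n.+2) \sum_(j < n.+2 | (j < i)%N) `|current W p i j|.
Proof.
rewrite current_form exchange_big /=.
pose x i := Normc.normc (tnth v l i 0); pose y i := Normc.normc (tnth v k i 0).
apply: le_trans (_ : \sum_i \sum_j `|current W p i j| * (x i * y j) <= _).
  apply: le_trans (normc_sum_le _ _ _) _; apply: ler_sum => i _.
  apply: le_trans (normc_sum_le _ _ _) _; apply: ler_sum => j _.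
  by rewrite !Normc.normcM normcJ normc_real mulrAC mulrC mulrA mulrC.
rewrite sum_pairs; last by move=> i; rewrite /current subrr normr0 mul0r.
apply: ler_sum => i _; apply: ler_sum => j ji.
rewrite (currentC i j) normrN -mulrDr ler_piMr //.
have pair (u : 'I_n.+2) : Normc.normc (tnth v u i 0) ^+ 2 +
    Normc.normc (tnth v u j 0) ^+ 2 <= 1.
  rewrite -(sum_normc_sqr u) (bigD1 i) //= lerD2l (bigD1 j) /=; last first.
    by apply: contraTneq ji => ->; rewrite ltnn.
  by rewrite lerDl sumr_ge0 // => m _; rewrite sqr_ge0.
have := pair l; have := pair k; rewrite -/(x i) -/(x j) -/(y i) -/(y j).
have := sqr_ge0 (x i - y j); have := sqr_ge0 (x j - y i).
nra.
Qed.

Hypotheses (hW : transition_rate_matrix W) (hp : steady_state W p).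

(** Kirchhoff's law: the inflow sum is a row of [W *m p = 0], the outflow sum a vanishing column sum
    of [W]. *)
Lemma sum_current m : \sum_k current W p m k = 0.
Proof.
have [_ _ /matrixP/(_ m 0)] := hp; rewrite !mxE => Wp.
rewrite /current big_split /= sumrN /flux Wp -mulr_suml.
have [_ Wc] := hW; rewrite (bigD1 m) //= Wc.
by rewrite addNr mul0r subr0.
Qed.

(** Row and column sums of the currents vanish, so the current form is 0 against the constant
    eigenvector; with exactly one index 0, the factor [lam l - (lam k)^*] is nonzero by the spectral
    gap. *)
Lemma gram_eq0 l k : (l == 0) != (k == 0) -> gram p v l k = 0.
Proof.
have [c vc] := first_eigenvector hspec.
have lam_neq0 u : u != 0 -> lam u != 0.
  move=> u0; apply: contraTneq (second_eigenvalue hspec) => lu.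
  have := eigenvalues_ordered hspec (i := 1) (j := u); rewrite lu /= -leNgt; apply.
  by rewrite lt0n.
have form0 : (l == 0) || (k == 0) ->
    (lam l - (lam k)^*%C) * gram p v l k = 0.
  rewrite gram_current current_form; case/orP => /eqP ->.
    rewrite big1 // => j _; rewrite -mulr_suml vc.
    under eq_bigr do rewrite !mxE mulr1 currentC rmorphN mulrN.
    by rewrite sumrN -mulr_sumr -rmorph_sum sum_current rmorph0 mulr0 oppr0 mul0r.
  rewrite exchange_big big1 // => i _; rewrite vc.
  under eq_bigr do rewrite !mxE mulr1.
  by rewrite -mulr_suml -mulr_sumr -rmorph_sum sum_current rmorph0 mulr0 mul0r.
have [l0|l0] := eqVneq l 0; have [k0|k0] := eqVneq k 0 => // _.
  move: form0; rewrite l0 eqxx (first_eigenvalue hspec) => /(_ isT) /eqP.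
  by rewrite mulf_eq0 sub0r oppr_eq0 conjc_eq0 (negbTE (lam_neq0 _ k0)) /= => /eqP.
move: form0; rewrite k0 eqxx orbT (first_eigenvalue hspec) => /(_ isT) /eqP.
by rewrite mulf_eq0 conjc0 subr0 (negbTE (lam_neq0 _ l0)) /= => /eqP.
Qed.

(* The terms of the expansion involving the constant eigenvector vanish, and
   the others are controlled by [|cexp z - cexp w| <= expR (- g tau) |z - w|]. *)
Lemma normc_asymmetry_term_le l k (tau : R) : 0 <= tau ->
  Normc.normc ((cexp (tau%:C * lam l) - (cexp (tau%:C * lam k))^*%C) * gram p v l k)
  <= (l != 0)%:R * (k != 0)%:R * (tau * expR (- spectral_gap lam * tau) *
     \sum_(i < n.+2) \sum_(j < n.+2 | (j < i)%N) `|current W p i j|).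
Proof.
move=> tau0.
have [l0|l0] := eqVneq l 0; have [k0|k0] := eqVneq k 0.
- rewrite l0 k0 (first_eigenvalue hspec) mulr0 cexp0 conjc1 subrr mul0r.
  by rewrite Normc.normc0 !mul0r.
- by rewrite gram_eq0 ?l0 ?eqxx ?(negbTE k0) // mulr0 Normc.normc0 !mul0r.
- by rewrite gram_eq0 ?k0 ?eqxx ?(negbTE l0) // mulr0 Normc.normc0 mulr0 mul0r.
rewrite !mul1r Normc.normcM -cexpJ.
have Re_le u : u != 0 -> complex.Re (tau%:C * lam u) <= - spectral_gap lam * tau.
  move=> u0; rewrite /spectral_gap opprK.
  have : complex.Re (lam u) <= complex.Re (lam 1).
    by apply: (eigenvalues_ordered hspec); rewrite lt0n.
  by case: (lam u) => a b /= h; rewrite mul0r subr0 [leRHS]mulrC ler_wpM2l.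
have Re_leJ u : u != 0 -> complex.Re (tau%:C * lam u)^*%C <= - spectral_gap lam * tau.
  by move=> /Re_le; case: (_ * _).
apply: le_trans (_ : expR (- spectral_gap lam * tau) *
  Normc.normc (tau%:C * lam l - (tau%:C * lam k)^*%C) * Normc.normc (gram p v l k) <= _).
  by rewrite ler_wpM2r ?normc_ge0 // normc_cexpB_le ?Re_le ?Re_leJ.
have -> : tau%:C * lam l - (tau%:C * lam k)^*%C = tau%:C * (lam l - (lam k)^*%C).
  case: (lam l) (lam k) => [x y] [x' y']; apply/eqP; rewrite eq_complex /=.
  by apply/andP; split; apply/eqP; ring.
rewrite Normc.normcM normc_real (ger0_norm tau0) mulrA -mulrA -Normc.normcM gram_current.
rewrite (mulrC tau) ler_wpM2l ?mulr_ge0 ?expR_ge0 //.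
exact: normc_current_form_le.
Qed.

Lemma asymmetry_le (a b : 'cV[R]_n.+2) (tau : R) : 0 <= tau ->
  `|correlation_asymmetry W p b a tau| <=
  star_norm v (complex_mx a) * star_norm v (complex_mx b) *
  (tau * expR (- spectral_gap lam * tau) *
     \sum_(i < n.+2) \sum_(j < n.+2 | (j < i)%N) `|current W p i j|).
Proof.
move=> tau0; rewrite -normc_real (correlation_asymmetry_gram p hspec).
set T := tau * _ * _.
apply: le_trans (normc_sum_le _ _ _) _.
(* The restricted sums of [star_norm] become full sums with a zero term at index 0, matching the
   Boolean factors of the termwise bound. *)
rewrite /star_norm [X in _ <= X * _ * _]big_mkcond /= !mulr_suml.
apply: ler_sum => k _.
apply: le_trans (normc_sum_le _ _ _) _.
rewrite [X in _ <= _ * X * _]big_mkcond /= mulr_sumr mulr_suml.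
apply: ler_sum => l _.
rewrite Normc.normcM (Normc.normcM (_^*)%C) normcJ -mulrA.
apply: le_trans (_ : Normc.normc (coord v l (complex_mx b)) *
  ((l != 0)%:R * (k != 0)%:R * T * Normc.normc (coord v k (complex_mx a))) <= _).
  rewrite ler_wpM2l ?normc_ge0 // ler_wpM2r ?normc_ge0 //.
  exact: normc_asymmetry_term_le.
rewrite le_eqVlt; apply/orP; left; apply/eqP.
by case: (l != 0); case: (k != 0) => /=; ring.
Qed.

End Currents.

(** * Opposite steady-state fluxes vanish together *)

Section SteadyStateFluxes.
Context {R : realType} {n : nat}.
Variables (W : 'M[R]_n.+2) (p : 'cV[R]_n.+2).
Hypotheses (hW : transition_rate_matrix W) (hldb : local_detailed_balance W)
  (hp : steady_state W p).

(* In the balance equation at an empty state [k], all inflows vanish. *)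
Lemma steady_state_eq0 (m k : 'I_n.+2) :
  m != k -> 0 < W k m -> p k 0 = 0 -> p m 0 = 0.
Proof.
move=> mk Wkm pk; have [p0 _ /matrixP/(_ k 0)] := hp; rewrite !mxE.
rewrite (bigD1 k) //= pk mulr0 add0r => /psumr_eq0P H.
have /eqP : W k m * p m 0 = 0.
  by apply: H => // i ik; rewrite mulr_ge0 // hW.1 // eq_sym.
by rewrite mulf_eq0 (gt_eqF Wkm) => /eqP.
Qed.

(** Local detailed balance makes the two rates vanish together; when both are positive, the two
    occupation probabilities vanish together. *)
Lemma flux_pair_steady (m k : 'I_n.+2) : m != k ->
  flux_pair (flux W p m k) (flux W p k m).
Proof.
move=> mk; have km : k != m by rewrite eq_sym.
have [p0 _ _] := hp; have [Wge0 _] := hW.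
rewrite /flux; case: (ltrP 0 (W m k)) => [Wmk|Wmk].
  have Wkm : 0 < W k m by apply/(hldb mk).
  have [pk|pk] := eqVneq (p k 0) 0.
    by right; rewrite pk (steady_state_eq0 mk Wkm pk) !mulr0.
  have [pm|pm] := eqVneq (p m 0) 0.
    by right; rewrite pm (steady_state_eq0 km Wmk pm) !mulr0.
  by left; rewrite !mulr_gt0 // lt0r ?pk ?pm p0.
have Wkm : W k m <= 0.
  by rewrite leNgt; apply/negP => /(hldb km); rewrite ltNge Wmk.
have -> : W m k = 0 by apply/eqP; rewrite eq_le Wmk Wge0.
have -> : W k m = 0 by apply/eqP; rewrite eq_le Wkm Wge0.
by right; rewrite !mul0r.
Qed.

End SteadyStateFluxes.

(* For sigma = 0 the middle term is 0, since 0 / x = 0 for every x. *)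
Theorem mainTheorem1 (R : realType) (n : nat) (W : 'M[R]_n.+2)
    (p : 'cV[R]_n.+2) (lam : 'I_n.+2 -> R[i])
    (v : n.+2.-tuple 'cV[R[i]]_n.+2) (a b : 'cV[R]_n.+2) (tau : R)
    (hW : transition_rate_matrix W)
    (hldb : local_detailed_balance W)
    (hp : steady_state W p)
    (hspec : spectral_assumptions W lam v)
    (hab : star_norm v (complex_mx a) * star_norm v (complex_mx b) <> 0)
    (htau : 0 <= tau) :
  let g := spectral_gap lam in
  let sigma := entropy_production W p in
  let gamma := dynamical_activity W p in
  let kappa := state_mobility W p in
  `|correlation_asymmetry W p b a tau|
      / (star_norm v (complex_mx a) * star_norm v (complex_mx b))
    <= tau * expR (- g * tau) * (sigma / Phi (sigma / (2 * gamma)))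
  /\
  tau * expR (- g * tau) * (sigma / Phi (sigma / (2 * gamma)))
    <= 2 * tau * expR (- g * tau) * Num.sqrt (sigma * kappa).
Proof.
move=> g sigma gamma kappa.
(* Edges are encoded as pairs with [ij.2 < ij.1], which turns the double sums into the single sums
   treated above. *)
pose P (ij : 'I_n.+2 * 'I_n.+2) := (ij.2 < ij.1)%N.
pose x (ij : 'I_n.+2 * 'I_n.+2) := flux W p ij.1 ij.2.
pose z (ij : 'I_n.+2 * 'I_n.+2) := flux W p ij.2 ij.1.
have sumE (F : 'I_n.+2 -> 'I_n.+2 -> R) :
    \sum_(i < n.+2) \sum_(j < n.+2 | (j < i)%N) F i j = \sum_(ij | P ij) F ij.1 ij.2.
  by rewrite pair_big_dep.
have xz ij : P ij -> flux_pair (x ij) (z ij).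
  move=> Pij; apply: flux_pair_steady => //.
  by apply: contraTneq Pij => E; rewrite /P E ltnn.
have E0 : 0 <= tau * expR (- g * tau) by rewrite mulr_ge0 ?expR_ge0.
rewrite /sigma /gamma /kappa /entropy_production /dynamical_activity.
rewrite /state_mobility !sumE; split; last first.
  rewrite -!(mulrA 2) (mulrCA 2) ler_wpM2l //.
  exact: (Phi_le_sqrt xz).
have ab0 : 0 < star_norm v (complex_mx a) * star_norm v (complex_mx b).
  rewrite lt0r (introN eqP hab) mulr_ge0 // sumr_ge0 // => i _; exact: normc_ge0.
rewrite ler_pdivrMr // mulrC.
apply: le_trans (asymmetry_le hspec hW hp a b htau) _.
rewrite ler_wpM2l ?(ltW ab0) // ler_wpM2l // sumE.
exact: (sum_abs_sub_le_Phi xz).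
Qed.
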